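(* A school choice market $\mathcal{E}=(\succ,P,q)$ satisfies the generalized mutually best pairs (GMBP) condition if and only if $\mathcal{E}$ admits a unique envyfree allocation and that envyfree allocation is (Pareto) efficient.
   Context: **Market.** $I$ is a finite set of $n$ students, $S$ a finite set of $m$ schools, and $s_{m+1}\notin S$ is the outside option, treated as an additional school with capacity $q_{s_{m+1}}=n$. Write $\bar S=S\cup\{s_{m+1}\}$. A market $\mathcal{E}=(\succ,P,q)$ consists of: for each student $i$ a strict linear order $\succ_i$ on $\bar S$ (with $\succeq_i$ its weak version); capacities $q_s\ge 1$ (integers) for $s\in S$; and for each $s\in S$ a strict linear order $P_s$ (priority list) on the set of students who find $s$ acceptable, i.e. with $s\succ_i s_{m+1}$ ($iP_sj$: $i$ has higher priority than $j$). The outside option has an arbitrary strict priority order over all of $I$. **Allocations.** An allocation is a map $\mu:I\to\bar S$; it is feasible if $|\mu^{-1}(s)|\le q_s$ for all $s$. A feasible $\mu$ is efficient if there is no feasible $\mu'$ with $\mu'(i)\succeq_i\mu(i)$ for all $i$ and $\mu'(i)\succ_i\mu(i)$ for some $i$. A pair $(i,s)$, $s\in\bar S$, blocks $\mu$ if $s\succ_i\mu(i)$ and either $|\mu^{-1}(s)|<q_s$ or $iP_sj$ for some $j\in\mu^{-1}(s)$. A feasible allocation is envyfree (stable) if no pair blocks it. **Simplified market.** School $s$ is irrelevant for student $i$ if there is $s'\ne s$ in $\bar S$ with $s'\succ_i s$, $i$ on the priority list of $s'$, and $|\{j: jP_{s'}i\}|<q_{s'}$. Iterative elimination of irrelevant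 schools: at each step, find for every student all irrelevant schools in the current market; delete them from the student's preference list and delete the student from the priority lists of these schools; repeat in the new market (the preference lists now being strict orders on the remaining schools, priorities being strict orders on the remaining students) until no student has an irrelevant school. The result is the simplified market $\mathcal{E}^*=(\succ^*,P^*,q)$; $\succ^*_i$ is a truncation of $\succ_i$ and $P^*_s$ a restriction of $P_s$. **SMBP.** A market (original or simplified) satisfies the sequential mutually best pairs (SMBP) condition if there are an ordering $i_1,\dots,i_n$ of the students and an associated list $s_{(1)},\dots,s_{(n)}$ of elements of $\bar S$, in which no school appears more often than its capacity, such that for every $k=1,\dots,n$, with remaining capacities $q_s^k=q_s-\sum_{l=1}^{k-1}1_{\{s_{(l)}=s\}}$ and $S^k=\{s\in\bar S:q^k_s>0\}$: (i) $s_{(k)}\in S^k$ is on $i_k$'s preference list and is $i_k$'s most preferred school among the schools of $S^k$ on $i_k$'s preference list; (ii) $i_k$ is on the priority list of $s_{(k)}$ and is among the top $q^k_{s_{(k)}}$ students of that list among the students $i_k,i_{k+1},\dots,i_n$. **GMBP.** $\mathcal{E}$ satisfies the generalized mutually best pairs condition if its simplified market $\mathcal{E}^*$ satisfies SMBP. *)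

(* Defs.v *)
From mathcomp Require Import all_boot.

Set Implicit Arguments.
Unset Strict Implicit.
Unset Printing Implicit Defensive.

(* [r] relates elements of [A] only, so that [r x y] says that both are on the
   list and that [x] comes before [y]. *)
Definition strict_linear_order_on (T : finType) (A : {set T}) (r : rel T) :
    Prop :=
  [/\ forall x y, r x y -> (x \in A) && (y \in A),
      irreflexive r,
      transitive r
    & forall x y, x \in A -> y \in A -> x != y -> r x y || r y x].

(* The schools are the [Some s] and the outside option is [None]. The lists
   carry their own domains because elimination shortens them. *)
Record market (I S : finType) := Market {
  pref_dom : I -> {set option S};
  pref : I -> rel (option S);
  prio_dom : option S -> {set I};
  prio : option S -> rel I;
  capacity : option S -> nat
}.

Section Market.
Context (I S : finType).
Implicit Types (E : market I S) (mu : {ffun I -> option S}).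
Implicit Types (i j : I) (s t : option S).

Record school_choice_market E : Prop := SchoolChoiceMarket {
  pref_dom_full : forall i, pref_dom E i = [set: option S];
  pref_linear : forall i, strict_linear_order_on (pref_dom E i) (pref E i);
  prio_dom_school : forall s : S,
    prio_dom E (Some s) = [set i | pref E i (Some s) None];
  prio_dom_outside : prio_dom E None = [set: I];
  prio_linear : forall s, strict_linear_order_on (prio_dom E s) (prio E s);
  capacity_school : forall s : S, 1 <= capacity E (Some s);
  capacity_outside : capacity E None = #|I|
}.

Definition assigned mu s : {set I} := [set i | mu i == s].

Definition feasible E mu : Prop :=
  forall s, #|assigned mu s| <= capacity E s.

Definition weak_pref E i s t : bool := (s == t) || pref E i s t.

Definition pareto_improves E mu' mu : Prop :=
  (forall i, weak_pref E i (mu' i) (mu i)) /\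
  (exists i, pref E i (mu' i) (mu i)).

Definition efficient E mu : Prop :=
  feasible E mu /\ ~ (exists mu', feasible E mu' /\ pareto_improves E mu' mu).

Definition blocks E mu i s : Prop :=
  pref E i s (mu i) /\
  (#|assigned mu s| < capacity E s \/
   exists2 j, j \in assigned mu s & prio E s i j).

Definition envyfree E mu : Prop :=
  feasible E mu /\ forall i s, ~ blocks E mu i s.

Definition irrelevant E i s : bool :=
  (s \in pref_dom E i) &&
  [exists t, [&& t != s, pref E i t s, i \in prio_dom E t
               & #|[set j | prio E t j i]| < capacity E t]].

Definition eliminate E : market I S :=
  let D i := [set s in pref_dom E i | ~~ irrelevant E i s] in
  let Q s := [set i in prio_dom E s | ~~ irrelevant E i s] in
  {| pref_dom := D;
     pref := fun i s t => [&& s \in D i, t \in D i & pref E i s t];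
     prio_dom := Q;
     prio := fun s i j => [&& i \in Q s, j \in Q s & prio E s i j];
     capacity := capacity E |}.

Definition no_irrelevant E : bool := [forall i, forall s, ~~ irrelevant E i s].

Lemma elimination_terminates E : exists k, no_irrelevant (iter k eliminate E).
Proof.
have [b] := ubnP (\sum_i #|pref_dom E i|); elim: b E => // b IHb E ltEb.
have [nirr|] := boolP (no_irrelevant E); first by exists 0.
case/forallPn=> i /forallPn[s]; rewrite negbK => irr.
have [|k nirr] := IHb (eliminate E); last by exists k.+1; rewrite iterSr.
rewrite -ltnS; apply: leq_trans ltEb; rewrite ltnS.
have sub j : pref_dom (eliminate E) j \subset pref_dom E j.
  by apply/subsetP=> t; rewrite inE => /andP[].
rewrite (bigD1 i) //= [leqRHS](bigD1 i) //= -addSn leq_add //.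
  apply/proper_card/properP; split; first exact: sub.
  by exists s; [case/andP: irr | rewrite inE irr andbF].
by apply: leq_sum => j _; apply/subset_leq_card/sub.
Qed.

Definition simplified E : market I S :=
  iter (ex_minn (elimination_terminates E)) eliminate E.

(* Capacity left when the student of index [k] (counted from 0) is reached.
   The subtraction is never truncated in [SMBP], which bounds the number of
   occurrences of each school in [sch]. *)
Definition remaining_capacity E (sch : 'I_#|I| -> option S) (k : 'I_#|I|) s :
    nat :=
  capacity E s - #|[set l : 'I_#|I| | (l < k) && (sch l == s)]|.

Definition SMBP E : Prop :=
  exists (stu : 'I_#|I| -> I) (sch : 'I_#|I| -> option S),
  [/\ bijective stu,
      forall s, #|[set k | sch k == s]| <= capacity E s
    & forall k,
      let q := remaining_capacity E sch k in
      [/\ 0 < q (sch k),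
          sch k \in pref_dom E (stu k),
          forall t, 0 < q t -> t \in pref_dom E (stu k) ->
            weak_pref E (stu k) (sch k) t,
          stu k \in prio_dom E (sch k)
        & #|[set l : 'I_#|I| | (k <= l) && prio E (sch k) (stu l) (stu k)]|
            < q (sch k)]].

Definition GMBP E : Prop := SMBP (simplified E).

End Market.

(* Main.v *)
Require Import Defs.
From mathcomp Require Import all_boot.

(** Call a school secured for a student if the student is among its top
  candidates, up to capacity, on its current list. In the simplified market each
  student has exactly one secured school [g i], which closes the student's
  list. The allocation [g] is envyfree: if a student prefers [s] to [g i], the
  students who rank highest at [s] fill [s] under [g]. Every envyfree allocation
  is weakly above [g], as elimination never removes a school that an envyfree
  allocation uses.

  Under SMBP, induction along the given order shows that any feasible allocation
  weakly above [g] is bounded above by the allocation of the mutually best pairs,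
  and that an envyfree one coincides with it. Conversely, if [g] is efficient,
  no nonempty set of students has each of its members envying, under [g], another
  member: the trading cycle would be an improvement. So the students can be
  ordered such that nobody envies a later one, and this order witnesses SMBP. *)

Set Implicit Arguments.
Unset Strict Implicit.
Unset Printing Implicit Defensive.

(** * Finite strict linear orders and their initial segments *)

Section LinearOrders.
Context (T : finType).
Implicit Types (A B : {set T}) (r : rel T) (x y : T).

Lemma strict_linear_order_on_restrict A B r :
  strict_linear_order_on A r -> B \subset A ->
  strict_linear_order_on B (fun x y => [&& x \in B, y \in B & r x y]).
Proof.
move=> [rA irr tr tot] /subsetP sBA; split=> [x y|x|y x z|x y xB yB neq].
- by case/and3P=> -> ->.
- by rewrite irr !andbF.
- by case/and3P=> -> _ rxy /and3P[_ -> ryz]; rewrite (tr _ _ _ rxy ryz).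
- by rewrite xB yB /=; apply: tot => //; apply: sBA.
Qed.

Lemma strict_linear_order_on_asym A r x y :
  strict_linear_order_on A r -> r x y -> ~~ r y x.
Proof.
by case=> _ irr tr _ rxy; apply/negP=> /(tr _ _ _ rxy); rewrite irr.
Qed.

Lemma card_below_ltn A r x y : strict_linear_order_on A r -> r x y ->
  #|[set z | r z x]| < #|[set z | r z y]|.
Proof.
case=> _ irr tr _ rxy; apply/proper_card/properP; split.
  by apply/subsetP=> z; rewrite !inE => rzx; apply: tr rzx rxy.
by exists x; rewrite !inE ?irr.
Qed.

(** The ranks, that is the numbers of elements above, are distinct on [A] and less than [#|A|], so
    by pigeonhole they are exactly the numbers below [#|A|]; it remains to count those below [q]. *)
Lemma card_initial_segment A r q : strict_linear_order_on A r ->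
  #|[set x in A | #|[set y | r y x]| < q]| = minn q #|A|.
Proof.
move=> lin; have [rA irr _ tot] := lin; pose rk x := #|[set y | r y x]|.
have rk_inj : {in A &, injective rk}.
  move=> x y xA yA eqrk; apply/eqP/negPn/negP=> /(tot _ _ xA yA).
  by case/orP=> /(card_below_ltn lin); rewrite -!/(rk _) eqrk ltnn.
have rk_lt x : x \in A -> rk x < #|A|.
  move=> xA; apply/proper_card/properP; split; last by exists x; rewrite ?inE ?irr.
  by apply/subsetP=> y; rewrite inE => /rA/andP[].
have perm : perm_eq [seq rk x | x <- enum A] (iota 0 #|A|).
  have uq : uniq [seq rk x | x <- enum A].
    rewrite map_inj_in_uniq ?enum_uniq // => x y.
    by rewrite !mem_enum; apply: rk_inj.
  apply: uniq_perm; rewrite ?iota_uniq //.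
  apply: (uniq_min_size uq _ _).2.
    move=> _ /mapP[x xA ->]; rewrite mem_iota /= add0n rk_lt //.
    by rewrite mem_enum in xA.
  by rewrite size_iota size_map cardE.
have -> : #|[set x in A | rk x < q]| = \sum_(k <- [seq rk x | x <- enum A] | k < q) 1.
  by rewrite big_map big_enum_cond -sum1_card; apply: eq_bigl => x; rewrite !inE.
rewrite (perm_big _ perm) sum1_count -size_filter.
case: (leqP q #|A|) => leqA; first by rewrite (@filter_iota_ltn 0) ?size_iota ?subn0.
rewrite (@eq_in_filter _ _ predT) ?filter_predT ?size_iota // => k.
by rewrite mem_iota => /andP[_ /ltn_trans->].
Qed.

Lemma strict_linear_order_on_best A r (P : pred T) x :
  strict_linear_order_on A r -> P x -> {subset P <= A} ->
  exists2 y, P y & forall z, P z -> z != y -> r y z.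
Proof.
move=> lin Px sPA; have [_ _ _ tot] := lin.
case: (arg_minnP (fun y => #|[set z | r z y]|) Px) => y Py min_y.
exists y => // z Pz neq; have := tot z y (sPA _ Pz) (sPA _ Py) neq.
by case/orP=> // /(card_below_ltn lin); rewrite ltnNge min_y.
Qed.

End LinearOrders.

(** * Enumerations without forward edges, and cycles of self-maps *)

Section Orderings.
Context (T : finType).

(** An element without an edge into the remaining set is listed first, and the rest is enumerated by
    induction. *)
Lemma acyclic_enumeration (e : rel T) (R : {set T}) :
  (forall C : {set T}, C != set0 ->
     exists2 x, x \in C & {in C, forall y, ~~ e x y}) ->
  exists p : seq T, [/\ uniq p, p =i R & pairwise (fun x y => ~~ e x y) p].
Proof.
move=> sink; have [n] := ubnP #|R|; elim: n R => // n IHn R ltRn.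
have [->|/sink[x xR ex]] := eqVneq R set0.
  by exists [::]; split=> // x; rewrite inE.
have [|p [up pR ep]] := IHn (R :\ x).
  by rewrite -ltnS (leq_trans _ ltRn) // ltnS (cardsD1 x R) xR.
exists (x :: p); split=> [|y|] /=; first by rewrite pR !inE eqxx.
  by rewrite !inE pR !inE; case: eqVneq => // ->.
by rewrite ep andbT; apply/allP=> y; rewrite pR !inE => /andP[_]; apply: ex.
Qed.

(* A minimal nonempty set that [f] maps to itself is a union of [f]-cycles. *)
Lemma exists_subset_stable (f : T -> T) (R : {set T}) :
  R != set0 -> {in R, forall x, f x \in R} ->
  exists C : {set T}, [/\ C != set0, C \subset R & f @: C = C].
Proof.
move=> R0 fR; pose closed C := (C != set0) && (f @: C \subset C).
have closedR : closed R.
  by rewrite /closed R0; apply/subsetP=> _ /imsetP[x xR ->]; apply: fR.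
have [C /minsetP[/andP[C0 fC] minC] sCR] := minset_exists closedR.
exists C; split=> //; apply: minC => //; rewrite /closed imsetS // andbT.
by case/set0Pn: C0 => x xC; apply/set0Pn; exists (f x); apply: imset_f.
Qed.

End Orderings.

(** * Markets that arise during elimination *)

Section Truncations.
Context (I S : finType).
Implicit Types (E F : market I S) (mu : {ffun I -> option S}).
Implicit Types (i j : I) (s t : option S).

Definition secured F i s :=
  (i \in prio_dom F s) && (#|[set j | prio F s j i]| < capacity F s).

(** The invariant of elimination. Its last clause asks for a school secured in the current [F], not
    just at the time of the removal, so that it can be used in the simplified market. *)
Record truncation E F : Prop := Truncation {
  truncation_pref : forall i s t, pref F i s t =
    [&& s \in pref_dom F i, t \in pref_dom F i & pref E i s t];
  truncation_prio : forall s i j, prio F s i j =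
    [&& i \in prio_dom F s, j \in prio_dom F s & prio E s i j];
  truncation_prio_dom : forall s i,
    (i \in prio_dom F s) = (i \in prio_dom E s) && (s \in pref_dom F i);
  truncation_capacity : capacity F = capacity E;
  truncation_removed : forall i s, s \notin pref_dom F i ->
    exists2 t, secured F i t & pref E i t s
}.

Context E (hE : school_choice_market E).

Lemma pref_trans i : transitive (pref E i).
Proof. by have [] := pref_linear hE i. Qed.

Lemma pref_irr i : irreflexive (pref E i).
Proof. by have [] := pref_linear hE i. Qed.

Lemma pref_total i s t : s != t -> pref E i s t || pref E i t s.
Proof.
by have [_ _ _ tot] := pref_linear hE i; apply: tot; rewrite pref_dom_full ?inE.
Qed.

(** A secured school is on the student's current list, so irrelevance can be read off the
    preferences of [E]. *)
Lemma irrelevantP F i s : truncation E F ->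
  reflect (s \in pref_dom F i /\ exists2 t, secured F i t & pref E i t s)
          (irrelevant F i s).
Proof.
move=> trF; apply: (iffP andP) => -[sD].
  case/existsP=> t /and4P[_]; rewrite (truncation_pref trF) => /and3P[_ _ ts] iQ lt.
  by split=> //; exists t; rewrite // /secured iQ.
case=> t /andP[iQ lt] ts; split=> //; apply/existsP; exists t.
have tD : t \in pref_dom F i by move: iQ; rewrite (truncation_prio_dom trF) => /andP[].
rewrite (truncation_pref trF) tD sD ts iQ lt !andbT.
by apply: contraTneq ts => ->; rewrite pref_irr.
Qed.

Lemma truncation_refl : truncation E E.
Proof.
have pd i s : s \in pref_dom E i by rewrite pref_dom_full ?inE.
split=> // [i s t|s i j|s i|i s]; rewrite ?pd ?andbT //.
have [dom _ _ _] := prio_linear hE s.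
by case Pij: (prio E s i j); rewrite ?andbF //; have/andP[-> ->] := dom _ _ Pij.
Qed.

(** The school that witnesses an earlier removal may itself be removed in this round. The student's
    best secured school is not, and it stays secured because the set of students ranked above only
    shrinks. *)
Lemma truncation_eliminate F : truncation E F -> truncation E (eliminate F).
Proof.
move=> trF; split=> [i s t|s i j|s i||i s] /=.
- by rewrite !inE (truncation_pref trF); case: (s \in _); case: (t \in _); rewrite ?andbF.
- by rewrite !inE (truncation_prio trF); case: (i \in _); case: (j \in _); rewrite ?andbF.
- by rewrite !inE (truncation_prio_dom trF) andbA.
- exact: truncation_capacity trF.
move=> sN; have [t sec_t ts] : exists2 t, secured F i t & pref E i t s.
  have [sD|] := boolP (s \in pref_dom F i); last exact: truncation_removed trF i s.
  by move: sN; rewrite inE sD /= negbK => /irrelevantP-/(_ trF)[].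
have [|u sec_u best_u] := strict_linear_order_on_best (pref_linear hE i) sec_t.
  by move=> z _; rewrite pref_dom_full ?inE.
(* [u] is the best secured school, so no secured school makes it irrelevant. *)
exists u; last first.
  by have [<- //|/(best_u _ sec_t) ut] := eqVneq t u; apply: pref_trans ut ts.
have [uQ uq] := andP sec_u; have rel_u : ~~ irrelevant F i u.
  apply/irrelevantP=> // -[_ [z sec_z zu]].
  have neq : z != u by apply: contraTneq zu => ->; rewrite pref_irr.
  by have := pref_trans zu (best_u _ sec_z neq); rewrite pref_irr.
rewrite /secured inE uQ rel_u; apply: leq_ltn_trans uq; apply/subset_leq_card.
by apply/subsetP=> j; rewrite !inE => /and3P[].
Qed.

Lemma truncation_iter k : truncation E (iter k (@eliminate I S) E).
Proof.
by elim: k => [|k IHk]; [apply: truncation_refl | apply: truncation_eliminate].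
Qed.

Lemma truncation_simplified : truncation E (simplified E).
Proof. exact: truncation_iter. Qed.

Lemma no_irrelevant_simplified : no_irrelevant (simplified E).
Proof. by rewrite /simplified; case: ex_minnP. Qed.

(** * Envyfree allocations survive elimination *)

Lemma envyfree_acceptable mu i : envyfree E mu -> i \in prio_dom E (mu i).
Proof.
case=> _ nb; case Es: (mu i) => [s|]; last by rewrite prio_dom_outside ?inE.
rewrite prio_dom_school // inE; apply/negPn/negP=> accN; apply: (nb i None).
rewrite /blocks Es; split.
  by have/orP[] := pref_total i (isT : Some s != None) => // acc; rewrite acc in accN.
(* The outside option has room, since it does not hold [i]. *)
left; rewrite capacity_outside //; apply/proper_card/properP; split; first exact/subsetP.
by exists i; rewrite ?inE ?Es.
Qed.

(** Suppose a secured [t] made [mu i] irrelevant. Then [t] must be full under [mu], while fewer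
    students than its capacity are above [i] there. Some [j] assigned to [t] is thus not above [i],
    and [i] blocks with [t]. *)
Lemma envyfree_eliminate mu F : truncation E F -> envyfree E mu ->
  (forall i, mu i \in pref_dom F i) ->
  forall i, mu i \in pref_dom (eliminate F) i.
Proof.
move=> trF ef muD i; rewrite inE muD /=; apply/irrelevantP=> // -[_ [t /andP[iQ lt] ti]].
apply: (ef.2 i t); split=> //; case: ltnP => le_cap; [by left | right].
have /subsetPn[j jt] : ~~ (assigned mu t \subset [set j | prio F t j i]).
  apply/negP=> /subset_leq_card/(leq_trans le_cap).
  by rewrite leqNgt -(truncation_capacity trF) lt.
rewrite inE (truncation_prio trF) iQ /= => jN; exists j => //.
have jtE : mu j = t by move: jt; rewrite inE => /eqP.
have jQE := envyfree_acceptable j ef; rewrite jtE in jQE.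
have jQ : j \in prio_dom F t by rewrite (truncation_prio_dom trF) jQE -jtE muD.
have iQE : i \in prio_dom E t by move: iQ; rewrite (truncation_prio_dom trF) => /andP[].
have neq : i != j by apply: contraTneq ti => ->; rewrite jtE pref_irr.
have [_ _ _ tot] := prio_linear hE t.
by have := tot _ _ iQE jQE neq; move: jN; rewrite jQ /= => /negPf->; rewrite orbF.
Qed.

Lemma envyfree_simplified mu i : envyfree E mu -> mu i \in pref_dom (simplified E) i.
Proof.
move=> ef; rewrite /simplified; move: i; elim: (ex_minn _) => [|k IHk] i.
  by rewrite pref_dom_full ?inE.
exact: (envyfree_eliminate (truncation_iter k)).
Qed.

(** * Secured schools and the allocation [g] *)

Lemma secured_outside F i : truncation E F -> None \in pref_dom F i -> secured F i None.
Proof.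
move=> trF D; rewrite /secured (truncation_prio_dom trF) D prio_dom_outside // inE /=.
rewrite (truncation_capacity trF) capacity_outside //.
apply/proper_card/properP; split; first exact/subsetP.
have [_ irr _ _] := prio_linear hE None.
by exists i; rewrite ?inE // (truncation_prio trF) irr !andbF.
Qed.

(** Existence: either the outside option is still listed, hence secured, or its removal provides a
    secured school. Uniqueness: the better of two secured schools would make the other
    irrelevant. *)
Lemma secured_simplified : exists g : {ffun I -> option S},
  forall i s, secured (simplified E) i s = (s == g i).
Proof.
set F := simplified E; have trF : truncation E F := truncation_simplified.
have ex_sec i : exists s, secured F i s.
  have [D|/(truncation_removed trF)[s ? _]] := boolP (None \in pref_dom F i); last by exists s.
  by exists None; apply: secured_outside.
exists [ffun i => xchoose (ex_sec i)] => i s; rewrite ffunE.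
have := xchooseP (ex_sec i); move: (xchoose _) => t sec_t.
apply/idP/eqP=> [sec_s|-> //]; apply/eqP/negPn/negP=> /(pref_total i).
have nirr u v : secured F i u -> secured F i v -> ~~ pref E i u v.
  move=> sec_u sec_v; apply/negP=> uv.
  have/forallP/(_ i)/forallP/(_ v)/irrelevantP[] := no_irrelevant_simplified => //.
  split; last by exists u.
  by have/andP[] := sec_v; rewrite (truncation_prio_dom trF) => /andP[].
by rewrite (negPf (nirr s t _ _)) // (negPf (nirr t s _ _)).
Qed.

Context (g : {ffun I -> option S}).
Context (gP : forall i s, secured (simplified E) i s = (s == g i)).

Let F := simplified E.
Let trF : truncation E F := truncation_simplified.
Let capF : capacity F = capacity E := truncation_capacity trF.

Lemma secured_g i : secured F i (g i).
Proof. by rewrite gP. Qed.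

Lemma g_in_prio_dom i : i \in prio_dom F (g i).
Proof. by have/andP[] := secured_g i. Qed.

Lemma g_in_pref_dom i : g i \in pref_dom F i.
Proof. by have := g_in_prio_dom i; rewrite (truncation_prio_dom trF) => /andP[]. Qed.

(** A school worse than [g i] would be irrelevant because of [g i]; a removed school has a better
    secured one, which can only be [g i]. *)
Lemma pref_dom_simplified i s : (s \in pref_dom F i) = weak_pref E i s (g i).
Proof.
rewrite /weak_pref; have [->|neq] := eqVneq s (g i); first exact: g_in_pref_dom.
apply/idP/idP=> [sD|].
  have/orP[//|gs] := pref_total i neq.
  have/forallP/(_ i)/forallP/(_ s)/irrelevantP[] := no_irrelevant_simplified => //.
  by split=> //; exists (g i); first exact: secured_g.
apply: contraTT => /(truncation_removed trF)[t]; rewrite gP => /eqP-> gs.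
exact: (strict_linear_order_on_asym (pref_linear hE i)).
Qed.

Lemma prio_dom_simplified i s : (i \in prio_dom F s) = (s \in pref_dom F i).
Proof.
rewrite (truncation_prio_dom trF); case D: (s \in _); rewrite ?andbF // andbT.
case: s D => [s|] D; last by rewrite prio_dom_outside ?inE.
rewrite prio_dom_school // inE; move: D; rewrite pref_dom_simplified => sg.
(* If the outside option was removed, [g i] is better than it; otherwise it is secured and equals
   [g i]. Either way [s] is acceptable. *)
have [DN|/(truncation_removed trF)[t]] := boolP (None \in pref_dom F i); last first.
  rewrite gP => /eqP->; case/orP: sg => [/eqP-> //|]; apply: pref_trans.
by have := secured_outside trF DN; rewrite gP => /eqP gN; move: sg; rewrite -gN.
Qed.

Lemma mem_prio_dom_simplified i s : (i \in prio_dom F s) = weak_pref E i s (g i).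
Proof. by rewrite prio_dom_simplified pref_dom_simplified. Qed.

Lemma prio_simplified_linear s : strict_linear_order_on (prio_dom F s) (prio F s).
Proof.
have sub : prio_dom F s \subset prio_dom E s.
  by apply/subsetP=> i; rewrite (truncation_prio_dom trF) => /andP[].
have [dom irr tr tot] := strict_linear_order_on_restrict (prio_linear hE s) sub.
split=> [x y|x|y x z|x y]; rewrite !(truncation_prio trF); last exact: tot.
- exact: dom.
- exact: irr.
- exact: tr.
Qed.

Lemma assigned_gE s : assigned g s =
  [set i in prio_dom F s | #|[set j | prio F s j i]| < capacity F s].
Proof. by apply/setP=> i; rewrite !inE eq_sym -gP. Qed.

Lemma feasible_g : feasible E g.
Proof.
move=> s; rewrite assigned_gE card_initial_segment -?capF ?geq_minl //.
exact: prio_simplified_linear.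
Qed.

(** A school secured for a student is secured for everyone of higher priority there. *)
Lemma prio_secured i j : prio F (g i) j i -> g j = g i.
Proof.
move=> ji; have lin := prio_simplified_linear (g i).
apply/eqP; rewrite eq_sym -gP /secured; have [dom _ _ _] := lin.
have/andP[-> _] := dom _ _ ji; have/andP[_] := secured_g i.
exact/ltn_trans/(card_below_ltn lin).
Qed.

(** Student [i] is still on the list of [s] but not secured there, so at least [capacity E s]
    students are above [i], and the top ones among them fill [s]. *)
Lemma preferred_full i s : pref E i s (g i) ->
  #|assigned g s| = capacity E s /\ {in assigned g s, forall j, prio F s j i}.
Proof.
move=> sg; have lin := prio_simplified_linear s; have [dom irr _ tot] := lin.
have iQ : i \in prio_dom F s by rewrite mem_prio_dom_simplified /weak_pref sg orbT.
have neq : s != g i by apply: contraTneq sg => ->; rewrite pref_irr.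
have cap_le : capacity F s <= #|[set j | prio F s j i]|.
  by move: neq; rewrite -gP /secured iQ /= -leqNgt.
split=> [|j].
  rewrite assigned_gE card_initial_segment // -capF; apply/minn_idPl.
  apply: leq_trans cap_le _; apply/subset_leq_card/subsetP=> j.
  by rewrite inE => /dom/andP[].
rewrite assigned_gE inE => /andP[jQ lt].
have neqij : j != i by apply: contraTneq lt => ->; rewrite -leqNgt.
have/orP[//|/(card_below_ltn lin)] := tot _ _ jQ iQ neqij.
by rewrite ltnNge (leq_trans (ltnW lt) cap_le).
Qed.

Lemma envyfree_g : envyfree E g.
Proof.
split=> [|i s [sg]]; first exact: feasible_g.
have [full above] := preferred_full sg; rewrite full ltnn => -[//|[j /above ji ij]].
move: ji; rewrite (truncation_prio trF) => /and3P[_ _ ji].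
by have:= strict_linear_order_on_asym (prio_linear hE s) ij; rewrite ji.
Qed.

Lemma envyfree_weak_pref mu i : envyfree E mu -> weak_pref E i (mu i) (g i).
Proof. by move/(@envyfree_simplified _ i); rewrite pref_dom_simplified. Qed.

Lemma pref_simplified i s t : weak_pref E i s (g i) -> weak_pref E i t (g i) ->
  weak_pref F i s t = weak_pref E i s t.
Proof.
by rewrite -!pref_dom_simplified /weak_pref (truncation_pref trF) => -> ->.
Qed.

Lemma weak_pref_antisym i s t : weak_pref E i s t -> weak_pref E i t s -> s = t.
Proof.
case/orP=> [/eqP//|st] /orP[/eqP//|ts].
by have := pref_trans st ts; rewrite pref_irr.
Qed.

Lemma weak_pref_trans i s t u :
  weak_pref E i s t -> weak_pref E i t u -> weak_pref E i s u.
Proof.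
case/orP=> [/eqP->//|st] /orP[/eqP<-|tu]; first by rewrite /weak_pref st orbT.
by rewrite /weak_pref (pref_trans st tu) orbT.
Qed.

(** * From mutually best pairs to uniqueness and efficiency *)

Section Forward.
Context (stu : 'I_#|I| -> I) (sch : 'I_#|I| -> option S).
Context (stu_bij : bijective stu).
Context (schP : forall k, let q := remaining_capacity F sch k in
      [/\ 0 < q (sch k),
          sch k \in pref_dom F (stu k),
          forall t, 0 < q t -> t \in pref_dom F (stu k) ->
            weak_pref F (stu k) (sch k) t,
          stu k \in prio_dom F (sch k)
        & #|[set l : 'I_#|I| | (k <= l) && prio F (sch k) (stu l) (stu k)]|
            < q (sch k)]).

Lemma card_assigned_stu mu s :
  #|[set l | mu (stu l) == s]| = #|assigned mu s|.
Proof.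
rewrite -(@on_card_preimset _ _ stu); last exact: onW_bij.
by apply: eq_card => l; rewrite !inE.
Qed.

(** The earlier students take the same places under [mu] as in the sequence, so the place of [stu k]
    under [mu] is still free at its turn. *)
Lemma SMBP_above_feasible mu (k : 'I_#|I|) : feasible E mu ->
  (forall i, weak_pref E i (mu i) (g i)) ->
  (forall l : 'I_#|I|, l < k -> mu (stu l) = sch l) ->
  weak_pref E (stu k) (sch k) (mu (stu k)).
Proof.
move=> feas mug prev; have [_ schD best _ _] := schP k.
rewrite -pref_simplified -?pref_dom_simplified //; last by rewrite pref_dom_simplified.
apply: best; last by rewrite pref_dom_simplified.
rewrite subn_gt0 capF; apply: leq_trans (feas _); rewrite -card_assigned_stu.
apply/proper_card/properP; split.
  by apply/subsetP=> l; rewrite !inE => /andP[/prev->].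
by exists k; rewrite !inE ?ltnn.
Qed.

(** The induction shared by uniqueness and efficiency. The lower bound may use agreement on earlier
    students, which the envyfree case needs. *)
Lemma SMBP_unique_above mu mu0 : feasible E mu -> (forall i, weak_pref E i (mu i) (g i)) ->
  (forall k : 'I_#|I|, (forall l : 'I_#|I|, l < k -> mu (stu l) = sch l) ->
     weak_pref E (stu k) (mu (stu k)) (sch k)) ->
  (forall k, mu0 (stu k) = sch k) -> mu = mu0.
Proof.
move=> feas mug ge mu0P; apply/ffunP=> i; have [inv _ invK] := stu_bij.
rewrite -(invK i) mu0P; have [n] := ubnP (inv i); move: (inv i) => k.
elim: n k => // n IHn k ltkn.
have prev (l : 'I_#|I|) : l < k -> mu (stu l) = sch l.
  by move=> lk; apply: IHn; apply: leq_trans lk _.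
exact: weak_pref_antisym (ge k prev) (SMBP_above_feasible feas mug prev).
Qed.

(** If [sch k] were better, it would be full under [mu]. The earlier students there and those of
    higher priority are fewer than the capacity, so it also holds a later student of lower priority,
    and [stu k] blocks. *)
Lemma SMBP_envyfree mu (k : 'I_#|I|) : envyfree E mu ->
  (forall l : 'I_#|I|, l < k -> mu (stu l) = sch l) ->
  weak_pref E (stu k) (mu (stu k)) (sch k).
Proof.
move=> ef prev; have [_ schD _ kQ rk] := schP k; set s := sch k in schD kQ rk *.
have [<-|neq] := eqVneq s (mu (stu k)); first by rewrite /weak_pref eqxx.
rewrite /weak_pref; have/orP[s_mu|->] := pref_total (stu k) neq; last by rewrite orbT.
case: (ef.2 (stu k) s); split=> //; case: ltnP => [lt|full]; [by left | right].
pose before := [set l : 'I_#|I| | (l < k) && (sch l == s)].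
pose after := [set l : 'I_#|I| | (k <= l) && prio F s (stu l) (stu k)].
have /subsetPn[l] : ~~ ([set l | mu (stu l) == s] \subset before :|: after).
  apply/negP=> /subset_leq_card; rewrite card_assigned_stu => /(leq_trans full).
  rewrite leqNgt -capF; case/negP; apply: leq_ltn_trans (leq_card_setU _ _).1 _.
  by rewrite -ltn_subRL.
rewrite !inE => /eqP mul; rewrite ltnNge.
case: leqP => [kl|lk] /=; last by rewrite -prev // mul eqxx.
move=> lN; exists (stu l); first by rewrite inE mul.
have lQ : stu l \in prio_dom F s by rewrite mem_prio_dom_simplified -mul envyfree_weak_pref.
have neqkl : stu k != stu l by apply: contraNneq neq => ->; rewrite mul.
have [_ _ _ tot] := prio_simplified_linear s; have/orP[] := tot _ _ kQ lQ neqkl.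
  by rewrite (truncation_prio trF) => /and3P[].
by move=> lk; rewrite lk in lN.
Qed.

End Forward.

Lemma SMBP_unique_efficient : SMBP F ->
  (exists! mu : {ffun I -> option S}, envyfree E mu) /\
  (forall mu : {ffun I -> option S}, envyfree E mu -> efficient E mu).
Proof.
case=> stu [sch [stu_bij _ schP]]; have [inv stuK invK] := stu_bij.
pose mu0 := [ffun i => sch (inv i)].
have mu0P k : mu0 (stu k) = sch k by rewrite ffunE stuK.
have uniq_ef mu : envyfree E mu -> mu = mu0.
  move=> ef; apply: (SMBP_unique_above stu_bij schP ef.1 _ _ mu0P) => [i|k].
    exact: envyfree_weak_pref.
  exact: SMBP_envyfree.
split.
  exists g; split=> [|mu /uniq_ef->]; first exact: envyfree_g.
  exact: uniq_ef envyfree_g.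
move=> mu ef; split=> [|[mu' [feas [ge [i]]]]]; first exact: ef.1.
(* The improvement [mu'] need not be envyfree: its lower bound comes from dominating [mu], which
   equals [mu0]. *)
rewrite [mu'](SMBP_unique_above stu_bij schP feas _ _ mu0P) => [|j|k _].
- by rewrite (uniq_ef _ ef) pref_irr.
- exact: weak_pref_trans (ge j) (envyfree_weak_pref j ef).
- by rewrite -mu0P -(uniq_ef _ ef).
Qed.

(** * From efficiency of [g] to mutually best pairs *)

Lemma efficient_sink (R : {set I}) : efficient E g -> R != set0 ->
  exists2 i, i \in R & {in R, forall j, ~~ pref E i (g j) (g i)}.
Proof.
move=> [_ eff] R0.
have [/exists_inP[i iR /forall_inP noE]|] :=
  boolP [exists i in R, [forall j in R, ~~ pref E i (g j) (g i)]]; first by exists i.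
rewrite negb_exists_in => /forall_inP noS.
(* Each student of [R] points to one in [R] whom it envies; the default is never reached on [R]. *)
pose f i := odflt i [pick j in R | pref E i (g j) (g i)].
have fP i : i \in R -> (f i \in R) && pref E i (g (f i)) (g i).
  move=> /noS/negP nall; rewrite /f; case: pickP => [j //|none]; case: nall.
  by apply/forall_inP=> j jR; have := none j; rewrite jR /= => ->.
have [|C [C0 /subsetP CR fC]] := exists_subset_stable R0 (f := f).
  by move=> i /fP/andP[].
have f_inj : {in C &, injective f} by apply/imset_injP; rewrite fC.
(* The students of [C] trade along [f]. Since [f] permutes [C], the map [h] is injective and no
   school receives more students than under [g]. *)
case: eff; pose h i := if i \in C then f i else i.
have h_inj : injective h.
  have fm k : k \in C -> f k \in C by move=> kC; rewrite -fC imset_f.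
  rewrite /h => i j; case: ifP => iC; case: ifP => jC //; first exact: f_inj.
    by move=> fij; rewrite -fij fm in jC.
  by move=> fij; rewrite fij fm in iC.
exists [ffun i => g (h i)]; split.
  move=> s; apply: leq_trans (feasible_g s); rewrite -(card_preimset (assigned g s) h_inj).
  by apply/subset_leq_card/subsetP=> i; rewrite !inE ffunE.
split=> [i|].
  rewrite ffunE /h /weak_pref; case: ifP => [/CR/fP/andP[_ ->]|]; rewrite ?orbT ?eqxx //.
case/set0Pn: C0 => i iC; exists i; rewrite ffunE /h iC.
by have/andP[] := fP i (CR i iC).
Qed.

(** Each student is paired with its own school under [g]. A better school is full under [g]; if it
    had capacity left at this turn, a later student would hold a place there and be envied. *)
Lemma efficient_SMBP : efficient E g -> SMBP F.
Proof.
move=> eff; have [p [up p_all ep]] :=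
  acyclic_enumeration setT (fun C => efficient_sink (R := C) eff).
have sz : size p == #|I|.
  by rewrite -cardsT -(card_uniqP up); apply/eqP/eq_card => i; rewrite p_all.
pose stu := tnth (Tuple sz).
have stu_inj : injective stu by apply/tuple_uniqP.
have stu_bij : bijective stu by apply: inj_card_bij => //; rewrite card_ord.
have stu_sink (k l : 'I_#|I|) : k < l -> ~~ pref E (stu k) (g (stu l)) (g (stu k)).
  move=> kl; rewrite /stu !(tnth_nth (stu k)) /=.
  by move/pairwiseP: ep; apply; rewrite ?inE ?(eqP sz).
exists stu, (g \o stu); split=> // [s|k q /=].
  by rewrite (card_assigned_stu stu_bij) capF feasible_g.
pose i := stu k; pose s := g i; rewrite -/i -/s.
pose before t := [set l : 'I_#|I| | (l < k) && (g (stu l) == t)].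
have qE t : q t = capacity E t - #|before t| by rewrite -capF.
pose above := [set l : 'I_#|I| | (k <= l) && prio F s (stu l) i].
(* [before s] and [above] are disjoint, consist of students assigned to [s] by [g], and both omit
   [k], which is assigned there too. *)
have top : #|above| < q s.
  rewrite qE ltn_subRL; apply: leq_trans (feasible_g s).
  rewrite -(card_assigned_stu stu_bij) -cardsUI.
  have -> : before s :&: above = set0.
    by apply/setP=> l; rewrite !inE ltnNge; case: leqP; rewrite ?andbF.
  rewrite cards0 addn0; apply/proper_card/properP; split.
    by apply/subsetP=> l; rewrite !inE => /orP[/andP[]|/andP[_ /prio_secured->]].
  have [_ irr _ _] := prio_simplified_linear s.
  by exists k; rewrite !inE ?ltnn /= ?irr ?andbF.
split=> //; [exact: leq_ltn_trans top|exact: g_in_pref_dom| |exact: g_in_prio_dom].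
move=> t qt; rewrite pref_dom_simplified => tg.
rewrite pref_simplified //; last by rewrite -pref_dom_simplified g_in_pref_dom.
have/orP[/eqP->|tg'] := tg; first by rewrite /weak_pref eqxx.
have [full _] := preferred_full tg'.
have /subsetPn[l] : ~~ ([set l | g (stu l) == t] \subset before t).
  apply/negP=> /subset_leq_card; rewrite (card_assigned_stu stu_bij) full.
  by rewrite leqNgt -subn_gt0 -qE qt.
rewrite !inE => /eqP gl; rewrite gl eqxx andbT -leqNgt leq_eqVlt => /orP[/eqP/val_inj kl|kl].
  by move: tg'; rewrite -gl -kl pref_irr.
by have := stu_sink k l kl; rewrite gl tg'.
Qed.

End Truncations.

Theorem proposition3 (I S : finType) (E : market I S)
    (hE : school_choice_market E) :
  GMBP E <->
  (exists! mu : {ffun I -> option S}, envyfree E mu) /\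
  (forall mu : {ffun I -> option S}, envyfree E mu -> efficient E mu).
Proof.
have [g gP] := secured_simplified hE; split; first exact: SMBP_unique_efficient gP.
by case=> _ eff; apply/(efficient_SMBP hE gP)/eff/(envyfree_g hE gP).
Qed.
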